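(* Let $\mathcal{T}=((t,u),\mathcal{O},\{\mathcal{R}_1,\ldots,\mathcal{R}_k\})$ be a tiling whose obstructions are pairwise incomparable under containment, let $r$ be a row and $S$ a nonempty subset of the nonempty cells of row $r$ such that row separation applies to $(r,S)$, and let $\mathcal{T}'$ be the row-separated tiling defined in the context. Then for every $n\in\mathbb{N}$, the number of gridded permutations of size $n$ in $\operatorname{Grid}(\mathcal{T})$ equals the number in $\operatorname{Grid}(\mathcal{T}')$ (row separation is an equivalence strategy). The analogous statement holds for column separation, with the roles of rows and columns exchanged.
   Context: A gridded permutation of size $n$ is a pair $(\pi,(c_1,\ldots,c_n))$ with $\pi$ a permutation of $\{1,\ldots,n\}$ and cells $c_i=(x_i,y_i)\in\mathbb{N}^2$ such that $x_i\le x_j$ whenever $i<j$ and $y_i\le y_j$ whenever $\pi(i)<\pi(j)$; $\mathcal{G}^{(t,u)}$ is the set of those with all cells in $\{0,\ldots,t-1\}\times\{0,\ldots,u-1\}$. Containment $h\le g$: some subsequence of $g$'s permutation is order-isomorphic to $h$'s permutation and the corresponding cells of $g$ equal the cells of $h$. A tiling $((t,u),\mathcal{O},\mathcal{R})$ has obstructions $\mathcal{O}$ and requirement lists $\mathcal{R}$; its set $\operatorname{Grid}$ consists of elements of $\mathcal{G}^{(t,u)}$ avoiding every obstruction and containing at least one element of each requirement list. A cell $c$ is empty if $(1,(c))\in\mathcal{O}$, nonempty otherwise. Given row $r$ and $S$, let $S'$ be the remaining nonempty cells of row $r$. Row separation applies if for every $(c_1,c_2)\in S\times S'$: if $c_1$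 is in a column left of $c_2$ then $(21,(c_1,c_2))\in\mathcal{O}$, and if $c_1$ is in a column right of $c_2$ then $(12,(c_2,c_1))\in\mathcal{O}$; these required obstructions form the set $C$ of critical row patterns. Define $\gamma(i,j)=(i,j)$ if $j<r$, or if $j=r$ and column $i$ contains a cell of $S$; $\gamma(i,j)=(i,j+1)$ if $j>r$, or if $j=r$ and column $i$ contains no cell of $S$. For a gridded permutation $(\pi,(c_1,\ldots,c_n))$ let $\Gamma((\pi,(c_1,\ldots,c_n)))=(\pi,(\gamma(c_1),\ldots,\gamma(c_n)))$, and for a set $X$ let $\Gamma(X)=\{\Gamma(x):x\in X\}$, keeping only those images that are valid (consistent) gridded permutations. Let $\mathcal{O}'=\{(1,(i,r)): 0\le i<t,\ \text{column } i \text{ contains no cell of } S\}\cup\{(1,(i,r+1)): \text{column } i \text{ contains a cell of } S\}$. The row-separated tiling is $\mathcal{T}'=((t,u+1),\ \Gamma(\mathcal{O}\setminus C)\cup\mathcal{O}',\ \{\Gamma(\mathcal{R}_1),\ldots,\Gamma(\mathcal{R}_k)\})$. *)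

(* Defs.v *)
From mathcomp Require Import all_boot all_fingroup finmap.
From mathcomp Require Import all_classical.

Set Implicit Arguments.
Unset Strict Implicit.
Unset Printing Implicit Defensive.

Local Open Scope classical_set_scope.

(* A cell is (column, row), both counted from 0. *)
Definition cell : Type := (nat * nat)%type.

(* A permutation together with one cell per entry; entries are indexed by 'I_n
   and take values in 'I_n, that is {0, ..., n-1} instead of {1, ..., n}.
   Consistency of the cells is the separate predicate gridded below, so that
   Gamma is a total map whose inconsistent images are discarded afterwards. *)
Definition cperm : Type := {n : nat & ('S_n * n.-tuple cell)%type}.

Definition mkcperm (n : nat) (s : 'S_n) (c : n.-tuple cell) : cperm :=
  existT (fun n => ('S_n * n.-tuple cell)%type) n (s, c).

Definition gsize (g : cperm) : nat := projT1 g.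
Definition gperm (g : cperm) : 'S_(gsize g) := (projT2 g).1.
Definition gcells (g : cperm) : (gsize g).-tuple cell := (projT2 g).2.
Definition gcell (g : cperm) (i : 'I_(gsize g)) : cell := tnth (gcells g) i.

Definition gridded (g : cperm) : Prop :=
  forall i j : 'I_(gsize g),
    (i < j -> (gcell i).1 <= (gcell j).1) /\
    (gperm g i < gperm g j -> (gcell i).2 <= (gcell j).2).

Definition in_grid (t u : nat) (c : cell) : Prop := c.1 < t /\ c.2 < u.

Definition gridded_in (t u : nat) : set cperm :=
  [set g | gridded g /\ forall i : 'I_(gsize g), in_grid t u (gcell i)].

Definition contained (h g : cperm) : Prop :=
  exists f : 'I_(gsize h) -> 'I_(gsize g),
    [/\ forall i j : 'I_(gsize h), i < j -> f i < f j,
        forall i j, (gperm h i < gperm h j) = (gperm g (f i) < gperm g (f j)) &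
        forall i, gcell (f i) = gcell i].

(* (1, (c)), (12, (c1, c2)) and (21, (c1, c2)). *)
Definition gp1 (c : cell) : cperm := mkcperm 1%g [tuple c].
Definition gp12 (c1 c2 : cell) : cperm :=
  mkcperm (1%g : 'S_2) [tuple c1; c2].
Definition gp21 (c1 c2 : cell) : cperm :=
  mkcperm (tperm ord0 ord_max : 'S_2) [tuple c1; c2].

(* The requirement lists R_1, ..., R_k are a family indexed by 'I_k. *)
Record tiling := Tiling {
  width : nat;
  height : nat;
  obs : set cperm;
  nreqs : nat;
  reqs : 'I_nreqs -> set cperm
}.

Definition tiling_wf (T : tiling) : Prop :=
  obs T `<=` gridded_in (width T) (height T) /\
  forall k : 'I_(nreqs T), reqs k `<=` gridded_in (width T) (height T).

Definition Grid (T : tiling) : set cperm :=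
  [set g | [/\ gridded_in (width T) (height T) g,
               forall o, obs T o -> ~ contained o g &
               forall k : 'I_(nreqs T), exists2 h, reqs k h & contained h g]].

Definition Grid_size (T : tiling) (n : nat) : set cperm :=
  Grid T `&` [set g | gsize g = n].

Definition num_Grid (T : tiling) (n : nat) : nat := #|` fset_set (Grid_size T n)|.

Definition incomparable (X : set cperm) : Prop :=
  forall g h, X g -> X h -> contained g h -> g = h.

Definition nonempty_cell (T : tiling) (c : cell) : Prop :=
  in_grid (width T) (height T) c /\ ~ obs T (gp1 c).

Definition map_cells (gam : cell -> cell) (g : cperm) : cperm :=
  mkcperm (gperm g) (map_tuple gam (gcells g)).

Definition Gamma (gam : cell -> cell) (X : set cperm) : set cperm :=
  [set h | gridded h /\ exists2 g, X g & h = map_cells gam g].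

Definition col_meets (S : set cell) (i : nat) : Prop := exists j, S (i, j).
Definition row_meets (S : set cell) (j : nat) : Prop := exists i, S (i, j).

(* Row separation: the cells of S are kept in row r and the other cells of
   row r are moved above them. *)

Definition row_cells (T : tiling) (r : nat) : set cell :=
  [set c | nonempty_cell T c /\ c.2 = r].

Definition row_sep_applies (T : tiling) (r : nat) (S : set cell) : Prop :=
  forall c1 c2, S c1 -> (row_cells T r `\` S) c2 ->
    (c1.1 < c2.1 -> obs T (gp21 c1 c2)) /\
    (c2.1 < c1.1 -> obs T (gp12 c2 c1)).

Definition row_critical (T : tiling) (r : nat) (S : set cell) : set cperm :=
  [set o | exists c1 c2, [/\ S c1, (row_cells T r `\` S) c2 &
     (c1.1 < c2.1 /\ o = gp21 c1 c2) \/ (c2.1 < c1.1 /\ o = gp12 c2 c1)]].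

Definition row_gamma (r : nat) (S : set cell) (c : cell) : cell :=
  if (c.2 < r) || (c.2 == r) && `[< col_meets S c.1 >] then c
  else (c.1, c.2.+1).

Definition row_new_obs (T : tiling) (r : nat) (S : set cell) : set cperm :=
  [set gp1 (i, r) | i in [set i | i < width T /\ ~ col_meets S i]] `|`
  [set gp1 (i, r.+1) | i in [set i | col_meets S i]].

Definition row_separated (T : tiling) (r : nat) (S : set cell) : tiling :=
  Tiling (width T) (height T).+1
    (Gamma (row_gamma r S) (obs T `\` row_critical T r S) `|`
     row_new_obs T r S)
    (fun k : 'I_(nreqs T) => Gamma (row_gamma r S) (reqs k)).

(* Column separation: the image of row separation under the reflection
   (pi, c) |-> (pi^-1, c^T), which sends (21, (c1, c2)) to (21, (c2^T, c1^T))
   and (12, (c2, c1)) to (12, (c2^T, c1^T)). The cells of S are kept in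
   column r and the other cells of column r are moved to their right. *)

Definition col_cells (T : tiling) (r : nat) : set cell :=
  [set c | nonempty_cell T c /\ c.1 = r].

Definition col_sep_applies (T : tiling) (r : nat) (S : set cell) : Prop :=
  forall c1 c2, S c1 -> (col_cells T r `\` S) c2 ->
    (c1.2 < c2.2 -> obs T (gp21 c2 c1)) /\
    (c2.2 < c1.2 -> obs T (gp12 c2 c1)).

Definition col_critical (T : tiling) (r : nat) (S : set cell) : set cperm :=
  [set o | exists c1 c2, [/\ S c1, (col_cells T r `\` S) c2 &
     (c1.2 < c2.2 /\ o = gp21 c2 c1) \/ (c2.2 < c1.2 /\ o = gp12 c2 c1)]].

Definition col_gamma (r : nat) (S : set cell) (c : cell) : cell :=
  if (c.1 < r) || (c.1 == r) && `[< row_meets S c.2 >] then c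
  else (c.1.+1, c.2).

Definition col_new_obs (T : tiling) (r : nat) (S : set cell) : set cperm :=
  [set gp1 (r, j) | j in [set j | j < height T /\ ~ row_meets S j]] `|`
  [set gp1 (r.+1, j) | j in [set j | row_meets S j]].

Definition col_separated (T : tiling) (r : nat) (S : set cell) : tiling :=
  Tiling (width T).+1 (height T)
    (Gamma (col_gamma r S) (obs T `\` col_critical T r S) `|`
     col_new_obs T r S)
    (fun k : 'I_(nreqs T) => Gamma (col_gamma r S) (reqs k)).

(* fset_set is the empty set on infinite arguments, so num_Grid counts the
   elements of Grid_size T n only because of this fact. *)
Lemma finite_Grid_size (T : tiling) (n : nat) : finite_set (Grid_size T n).
Proof.
pose t := width T; pose u := height T.
pose F (p : 'S_n * n.-tuple ('I_t * 'I_u)) : cperm :=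
  mkcperm p.1 (map_tuple (fun c : 'I_t * 'I_u => (c.1 : nat, c.2 : nat)) p.2).
apply: (@sub_finite_set _ _ (F @` setT)); last first.
  exact/finite_image/finite_finset.
move=> g [[[_ Hg] _ _]] /= gn; subst n; case: g @F Hg => m [s c] /= Hg.
exists (s, [tuple (Ordinal (Hg i).1, Ordinal (Hg i).2) | i < m]) => //.
congr (mkcperm _ _); apply: eq_from_tnth => i.
by rewrite tnth_map tnth_mktuple /= /gcell /gcells /=; case: (tnth c i).
Qed.

Lemma gridded_in_gp1 (t u : nat) (c : cell) :
  in_grid t u c -> gridded_in t u (gp1 c).
Proof.
move=> Hc; split=> [i j | i]; first by rewrite !ord1 !ltnn; split.
by rewrite ord1.
Qed.

Lemma row_separated_wf (T : tiling) (r : nat) (S : set cell) :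
  tiling_wf T -> r < height T -> S `<=` row_cells T r ->
  tiling_wf (row_separated T r S).
Proof.
move=> [HO HR] Hr HS.
have HG X : X `<=` gridded_in (width T) (height T) ->
    Gamma (row_gamma r S) X `<=` gridded_in (width T) (height T).+1.
  move=> HX h [Hh [g /HX[_ Hg] Eh]]; split=> //; subst h => i.
  rewrite /gcell tnth_map; have [H1 H2] := Hg i.
  by rewrite /row_gamma; case: ifP => _; split=> //=; apply: ltnW.
split=> [o [|]|k] /=; last exact: HG.
  by apply: HG => g [/HO].
case=> [[i [Hi _] <-]|[i [j /HS[[[Hi _] _] _]] <-]].
  by apply: gridded_in_gp1; split=> //=; apply: ltnW.
by apply: gridded_in_gp1; split.
Qed.

Lemma col_separated_wf (T : tiling) (r : nat) (S : set cell) :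
  tiling_wf T -> r < width T -> S `<=` col_cells T r ->
  tiling_wf (col_separated T r S).
Proof.
move=> [HO HR] Hr HS.
have HG X : X `<=` gridded_in (width T) (height T) ->
    Gamma (col_gamma r S) X `<=` gridded_in (width T).+1 (height T).
  move=> HX h [Hh [g /HX[_ Hg] Eh]]; split=> //; subst h => i.
  rewrite /gcell tnth_map; have [H1 H2] := Hg i.
  by rewrite /col_gamma; case: ifP => _; split=> //=; apply: ltnW.
split=> [o [|]|k] /=; last exact: HG.
  by apply: HG => g [/HO].
case=> [[j [Hj _] <-]|[j [i /HS[[[_ Hj] _] _]] <-]].
  by apply: gridded_in_gp1; split=> //=; apply: ltnW.
by apply: gridded_in_gp1; split.
Qed.

(* Main.v *)
Require Import Defs.
From mathcomp Require Import all_boot all_fingroup finmap.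
From mathcomp Require Import all_classical.

(** Relabelling the cells by gamma is a bijection from Grid T to Grid T'.
    Since gamma is injective on cells, it preserves and reflects containment.
    The critical patterns are the obstructions that gamma turns into
    inconsistent gridded permutations, and avoiding them is what makes the image
    of a gridded permutation of Grid T consistent; the new point obstructions
    forbid exactly the cells of the enlarged grid outside the image of gamma.
    Rows and columns are treated at once by abstracting these properties of
    gamma. *)

Local Open Scope classical_set_scope.

(** * Relabelling of cells, containment, and patterns of size one and two *)

Lemma gcell_map_cells (gam : cell -> cell) (g : cperm) (i : 'I_(gsize g)) :
  @gcell (map_cells gam g) i = gam (gcell i).
Proof. by rewrite /gcell tnth_map. Qed.

Lemma map_cellsK (gam del : cell -> cell) (g : cperm) :
  (forall i : 'I_(gsize g), del (gam (gcell i)) = gcell i) ->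
  map_cells del (map_cells gam g) = g.
Proof.
case: g => n [s c] H; congr (mkcperm _ _).
by apply: eq_from_tnth => i; rewrite !tnth_map; apply: H.
Qed.

Lemma contained_map_cells (gam : cell -> cell) (h g : cperm) :
  contained h g -> contained (map_cells gam h) (map_cells gam g).
Proof.
by case=> f [f1 f2 f3]; exists f; split=> // i; rewrite !gcell_map_cells f3.
Qed.

(** Consistency is a condition on pairs of entries, and an occurrence preserves order and cells.
    This is how relabelled patterns occurring in a consistent [g] are seen to survive in [Gamma]. *)
Lemma contained_gridded (h g : cperm) : contained h g -> gridded g -> gridded h.
Proof.
case=> f [f1 f2 f3] Hg i j; have [H1 H2] := Hg (f i) (f j).
by rewrite -!f3 f2; split=> // /f1.
Qed.

Lemma contained_gp1 (g : cperm) (i : 'I_(gsize g)) :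
  contained (gp1 (gcell i)) g.
Proof.
by exists (fun=> i); split=> [a b|a b|a]; rewrite ?(ord1 a) ?(ord1 b) ?ltnn.
Qed.

Lemma contained_gp1P (c : cell) (g : cperm) :
  contained (gp1 c) g -> exists i : 'I_(gsize g), gcell i = c.
Proof. by case=> f [_ _ /(_ ord0) H]; exists (f ord0); rewrite H. Qed.

Lemma ord2P (i : 'I_2) : i = ord0 \/ i = ord_max.
Proof. by case: i => [[|[|i]] Hi] //; [left|right]; apply: val_inj. Qed.

Lemma contained_gp12 (g : cperm) (i j : 'I_(gsize g)) :
  i < j -> gperm g i < gperm g j -> contained (gp12 (gcell i) (gcell j)) g.
Proof.
move=> Hij Hp.
have Hn : (gperm g j < gperm g i) = false by rewrite ltnNge ltnW.
exists (fun k : 'I_2 => if k == ord0 then i else j).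
split=> [a b|a b|a].
- by case: (ord2P a) => ->; case: (ord2P b) => ->.
- by rewrite {1 2}/gperm /= !perm1; case: (ord2P a) => ->;
    case: (ord2P b) => -> /=; rewrite ?ltnn ?Hp ?Hn.
- by case: (ord2P a) => ->.
Qed.

Lemma contained_gp21 (g : cperm) (i j : 'I_(gsize g)) :
  i < j -> gperm g j < gperm g i -> contained (gp21 (gcell i) (gcell j)) g.
Proof.
move=> Hij Hp.
have Hn : (gperm g i < gperm g j) = false by rewrite ltnNge ltnW.
exists (fun k : 'I_2 => if k == ord0 then i else j).
split=> [a b|a b|a].
- by case: (ord2P a) => ->; case: (ord2P b) => ->.
- by rewrite {1 2}/gperm /=; case: (ord2P a) => ->; case: (ord2P b) => ->;
    rewrite ?tpermL ?tpermR /= ?ltnn ?Hp ?Hn.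
- by case: (ord2P a) => ->.
Qed.

Lemma gridded_map_gp12 (gam : cell -> cell) (c d : cell) :
  gridded (map_cells gam (gp12 c d)) ->
  (gam c).1 <= (gam d).1 /\ (gam c).2 <= (gam d).2.
Proof.
move=> /(_ ord0 ord_max)[]; rewrite !gcell_map_cells /gperm /= !perm1.
by move=> H1 H2; split; [apply: H1|apply: H2].
Qed.

Lemma gridded_map_gp21 (gam : cell -> cell) (c d : cell) :
  gridded (map_cells gam (gp21 c d)) ->
  (gam c).1 <= (gam d).1 /\ (gam d).2 <= (gam c).2.
Proof.
move=> H; have [H1 _] := H ord0 ord_max; have [_ H2] := H ord_max ord0.
move: H1 H2; rewrite !gcell_map_cells /gperm /= tpermL tpermR.
by move=> H1 H2; split; [apply: H1|apply: H2].
Qed.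

Lemma Grid_nonempty_cell (T : tiling) (g : cperm) (i : 'I_(gsize g)) :
  Grid T g -> nonempty_cell T (gcell i).
Proof.
case=> [[_ Hg] Ho _]; split; first exact: Hg.
by move/Ho; apply; apply: contained_gp1.
Qed.

(** * The bijection for an abstract relabelling *)

Section Relabelling.

Variables (T : tiling) (w h : nat) (C N : set cperm) (gam del : cell -> cell).

Let T' := Tiling w h (Gamma gam (obs T `\` C) `|` N)
  (fun k : 'I_(nreqs T) => Gamma gam (reqs k)).

Hypothesis gamK : cancel gam del.
Hypothesis del_homo1 : forall c d, c.1 <= d.1 -> (del c).1 <= (del d).1.
Hypothesis del_homo2 : forall c d, c.2 <= d.2 -> (del c).2 <= (del d).2.
Hypothesis gam_in_grid :
  forall c, in_grid (width T) (height T) c -> in_grid w h (gam c).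
Hypothesis gam_gridded :
  forall g, Grid T g -> gridded (map_cells gam g).
Hypothesis critical_map_cells :
  forall o, C o -> ~ gridded (map_cells gam o).
Hypothesis new_obs_gp1 :
  forall o, N o -> exists2 c, o = gp1 c & gam (del c) <> c.
Hypothesis delK : forall c, in_grid w h c -> ~ N (gp1 c) ->
  gam (del c) = c /\ in_grid (width T) (height T) (del c).

Lemma contained_map_cells_inj (p g : cperm) :
  contained (map_cells gam p) (map_cells gam g) -> contained p g.
Proof.
move=> /(contained_map_cells del _ _).
by rewrite !map_cellsK// => i; rewrite gamK.
Qed.

Lemma Grid_map_cells (g : cperm) : Grid T g -> Grid T' (map_cells gam g).
Proof.
move=> Tg; have gg := gam_gridded _ Tg; case: Tg => [[_ Hin] Ho Hr]; split=> /=.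
- by split=> // i; rewrite gcell_map_cells; apply/gam_in_grid/Hin.
- move=> o [[_ [p [Op _] ->]]|/new_obs_gp1[c -> Hc]].
    by move/contained_map_cells_inj; apply: Ho.
  by move/contained_gp1P=> [i]; rewrite gcell_map_cells => E;
    apply: Hc; rewrite -E gamK.
- move=> k; have [p Rp pg] := Hr k.
  have pg' := contained_map_cells gam _ _ pg.
  (* [Gamma] keeps the image of [p] because it occurs in the consistent image of [g]. *)
  exists (map_cells gam p) => //; split; last by exists p.
  exact: contained_gridded _ _ pg' gg.
Qed.

(** Avoiding [N] forces every cell of [g] into the image of [gam], where [del] is a two-sided
    inverse; consistency survives because [del] is monotone in each coordinate. *)
Lemma Grid_map_cellsV (g : cperm) : Grid T' g ->
  Grid T (map_cells del g) /\ map_cells gam (map_cells del g) = g.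
Proof.
case=> [[gg Hin] Ho Hr].
have HN i : ~ N (gp1 (gcell (g := g) i)).
  by move=> Ni; apply: (Ho (gp1 (gcell i))); [right|apply: contained_gp1].
have gE : map_cells gam (map_cells del g) = g.
  by apply: map_cellsK => i; case: (delK _ (Hin i) (HN i)).
split=> //; split.
- split=> [i j|i]; last first.
    by rewrite gcell_map_cells; case: (delK _ (Hin i) (HN i)).
  rewrite !gcell_map_cells; have [H1 H2] := gg i j.
  by split=> Hij; [apply/del_homo1/H1|apply/del_homo2/H2].
(* The image of [o] would occur in the consistent [g], hence be consistent; so [o] is not critical
   and its image is an obstruction of [T']. *)
- move=> o Oo /(contained_map_cells gam _ _); rewrite gE => og.
  have go := contained_gridded _ _ og gg.
  apply: (Ho (map_cells gam o)) => //; left; split=> //; exists o => //.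
  by split=> // /critical_map_cells.
- move=> k; have [_ [_ [p Rp ->]]] := Hr k; rewrite -{1}gE.
  by move/contained_map_cells_inj; exists p.
Qed.

Lemma num_Grid_relabel (n : nat) : num_Grid T n = num_Grid T' n.
Proof.
rewrite /num_Grid.
have -> : Grid_size T' n = map_cells gam @` Grid_size T n.
  apply/seteqP; split=> [g [/Grid_map_cellsV[Tg gE] gn]|_ [g [Tg gn] <-]].
    by exists (map_cells del g).
  by split=> //; apply: Grid_map_cells.
rewrite fset_set_image; last exact: finite_Grid_size.
rewrite card_imfset//=; apply: (can_inj (g := map_cells del)) => g.
by apply: map_cellsK => i; rewrite gamK.
Qed.

End Relabelling.

(** * Undoing the separation by folding the two new lines together *)

Definition row_merge (r : nat) (c : cell) : cell :=
  (c.1, if c.2 <= r then c.2 else c.2.-1).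

Definition col_merge (r : nat) (c : cell) : cell :=
  (if c.1 <= r then c.1 else c.1.-1, c.2).

(** The inverse need not know [S]: cells left in place lie in rows at most [r], while moved cells
    land strictly above row [r]. *)
Lemma row_gammaK (r : nat) (S : set cell) :
  cancel (row_gamma r S) (row_merge r).
Proof.
move=> [i j]; rewrite /row_gamma /row_merge /=.
by case: (ltngtP j r) => [H|H|->] /=; first (by rewrite (ltnW H));
  last case: asboolP => _ /=; rewrite ?leqnn// leqNgt ltnS ?leqnn ?(ltnW H).
Qed.

Lemma col_gammaK (r : nat) (S : set cell) :
  cancel (col_gamma r S) (col_merge r).
Proof.
move=> [i j]; rewrite /col_gamma /col_merge /=.
by case: (ltngtP i r) => [H|H|->] /=; first (by rewrite (ltnW H));
  last case: asboolP => _ /=; rewrite ?leqnn// leqNgt ltnS ?leqnn ?(ltnW H).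
Qed.

Lemma merge_homo (r a b : nat) : a <= b ->
  (if a <= r then a else a.-1) <= (if b <= r then b else b.-1).
Proof.
move=> ab; case: (leqP a r) => ar; case: (leqP b r) => br //.
(* Here [a <= r < b], so lowering [b] by one cannot pass below [a]. *)
- by rewrite -ltnS (ltn_predK br); apply: leq_ltn_trans br.
- by move: (leq_trans ar (leq_trans ab br)); rewrite ltnn.
- by rewrite -!subn1 leq_sub2r.
Qed.

(** * Row and column separation as instances of the relabelling *)

Section Separation.

Variables (T : tiling) (r : nat) (S : set cell).

(** Columns are untouched, so consistency can only break when an entry of row [r] moves up while an
    entry of larger value stays in row [r]; such a pair is an occurrence of a critical pattern. *)
Lemma gridded_row_gamma (g : cperm) : S `<=` row_cells T r ->
  row_sep_applies T r S -> Grid T g -> gridded (map_cells (row_gamma r S) g).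
Proof.
move=> HS sep Tg; have [[gg _] Ho _] := Tg.
move=> /= i j; change 'I_(gsize g) in i, j.
rewrite !gcell_map_cells; have [H1 H2] := gg i j; split.
  by move=> /H1; rewrite /row_gamma; do 2!case: ifP => _.
rewrite -[gperm _]/(gperm g) => pij; have := H2 pij.
rewrite /row_gamma; case: ifPn => Hi; case: ifPn => Hj //=.
  by move/leq_trans; apply.
(* The remaining case: [i] moves and [j] stays. A strict inequality of rows absorbs the shift, so
   suppose the rows are equal; both are then row [r]. *)
move=> ij; rewrite ltn_neqAle ij andbT; apply/eqP=> eij.
move: Hi Hj; rewrite eij; case: ltngtP => //= jr.
case: asboolP => //= ni _; case: asboolP => //= -[k Sk] _.
have Sj : S (gcell j).
  by have [_ /= kr] := HS _ Sk; move: Sk; rewrite kr -jr -surjective_pairing.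
have Si : (row_cells T r `\` S) (gcell i).
  split; first by split; [apply: Grid_nonempty_cell|rewrite eij].
  by move=> Si; apply: ni; exists (gcell i).2; rewrite -surjective_pairing.
have [D1 D2] := sep _ _ Sj Si.
(* Consistency read backwards: distinct columns determine the order of positions, hence which of 12
   and 21 the pair forms. *)
have lt_of (a b : 'I_(gsize g)) : (gcell a).1 < (gcell b).1 -> a < b.
  rewrite !ltnNge; apply: contra; rewrite leq_eqVlt => /orP[/eqP/val_inj->//|].
  by case: (gg b a) => + _; apply.
case: (ltngtP (gcell i).1 (gcell j).1) => cij.
- exact: Ho _ (D2 cij) (contained_gp12 _ _ _ (lt_of _ _ cij) pij).
- exact: Ho _ (D1 cij) (contained_gp21 _ _ _ (lt_of _ _ cij) pij).
(* In a common column, the cell of [S] there would have kept [i] in place. *)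
- by apply: ni; rewrite cij; exists k.
Qed.

(** The mirror image: the order of positions is now given, and distinct rows determine the order of
    values. *)
Lemma gridded_col_gamma (g : cperm) : S `<=` col_cells T r ->
  col_sep_applies T r S -> Grid T g -> gridded (map_cells (col_gamma r S) g).
Proof.
move=> HS sep Tg; have [[gg _] Ho _] := Tg.
move=> /= i j; change 'I_(gsize g) in i, j.
rewrite !gcell_map_cells; have [H1 H2] := gg i j; split; last first.
  by move=> /H2; rewrite /col_gamma; do 2!case: ifP => _.
move=> lij; have := H1 lij.
rewrite /col_gamma; case: ifPn => Hi; case: ifPn => Hj //=.
  by move/leq_trans; apply.
move=> ij; rewrite ltn_neqAle ij andbT; apply/eqP=> eij.
move: Hi Hj; rewrite eij; case: ltngtP => //= jr.
case: asboolP => //= ni _; case: asboolP => //= -[k Sk] _.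
have Sj : S (gcell j).
  by have [_ /= kr] := HS _ Sk; move: Sk; rewrite kr -jr -surjective_pairing.
have Si : (col_cells T r `\` S) (gcell i).
  split; first by split; [apply: Grid_nonempty_cell|rewrite eij].
  by move=> Si; apply: ni; exists (gcell i).1; rewrite -surjective_pairing.
have [D1 D2] := sep _ _ Sj Si.
have lt_of (a b : 'I_(gsize g)) :
    (gcell a).2 < (gcell b).2 -> gperm g a < gperm g b.
  rewrite !ltnNge; apply: contra.
  rewrite leq_eqVlt => /orP[/eqP/val_inj/perm_inj->//|].
  by case: (gg b a) => _; apply.
case: (ltngtP (gcell i).2 (gcell j).2) => cij.
- exact: Ho _ (D2 cij) (contained_gp12 _ _ _ lij (lt_of _ _ cij)).
- exact: Ho _ (D1 cij) (contained_gp21 _ _ _ lij (lt_of _ _ cij)).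
- by apply: ni; rewrite cij; exists k.
Qed.

(** In both kinds of critical pattern the entry in [c1] has the larger value, yet [c1] stays in row
    [r] while [c2] moves to row [r.+1]. *)
Lemma row_critical_map_cells (o : cperm) : S `<=` row_cells T r ->
  row_critical T r S o -> ~ gridded (map_cells (row_gamma r S) o).
Proof.
move=> HS [c1 [c2 [S1 [[_ r2] nS2] D]]]; have [_ r1] := HS _ S1.
have E1 : row_gamma r S c1 = c1.
  rewrite /row_gamma r1 ltnn eqxx /=; case: asboolP => // -[].
  by exists r; rewrite -r1 -surjective_pairing.
have E2 : row_gamma r S c2 = (c2.1, r.+1).
  rewrite /row_gamma r2 ltnn eqxx /=; case: asboolP => // -[k Sk].
  case: nS2; have [_ /= kr] := HS _ Sk.
  by move: Sk; rewrite kr -r2 -surjective_pairing.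
by case: D => -[_ ->];
  [move/gridded_map_gp21|move/gridded_map_gp12];
  rewrite E1 E2 r1 /= ltnn => -[].
Qed.

(** In both kinds of critical pattern the entry in [c2] comes first, yet [c2] moves to column [r.+1]
    while [c1] stays in column [r]. *)
Lemma col_critical_map_cells (o : cperm) : S `<=` col_cells T r ->
  col_critical T r S o -> ~ gridded (map_cells (col_gamma r S) o).
Proof.
move=> HS [c1 [c2 [S1 [[_ r2] nS2] D]]]; have [_ r1] := HS _ S1.
have E1 : col_gamma r S c1 = c1.
  rewrite /col_gamma r1 ltnn eqxx /=; case: asboolP => // -[].
  by exists r; rewrite -r1 -surjective_pairing.
have E2 : col_gamma r S c2 = (r.+1, c2.2).
  rewrite /col_gamma r2 ltnn eqxx /=; case: asboolP => // -[k Sk].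
  case: nS2; have [_ /= kr] := HS _ Sk.
  by move: Sk; rewrite kr -r2 -surjective_pairing.
by case: D => -[_ ->];
  [move/gridded_map_gp21|move/gridded_map_gp12];
  rewrite E1 E2 r1 /= ltnn => -[].
Qed.

Lemma num_Grid_row_separated (n : nat) : r < height T ->
  S `<=` row_cells T r -> row_sep_applies T r S ->
  num_Grid T n = num_Grid (row_separated T r S) n.
Proof.
move=> Hr HS sep.
apply: (@num_Grid_relabel _ _ _ _ _ _ (row_merge r)) => //.
- exact: row_gammaK.
- by move=> c d; apply: merge_homo.
- by move=> c [c1 c2]; rewrite /row_gamma; case: ifP; split=> //; apply: ltnW.
- by move=> g; apply: gridded_row_gamma.
- by move=> o; apply: row_critical_map_cells.
(* Each forbidden cell folds to row [r], and [row_gamma] then sends it to the other of the rows [r]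
   and [r.+1]. *)
- move=> o [[i [_ ni] <-]|[i ci <-]];
    [exists (i, r) => //|exists (i, r.+1) => //];
    rewrite /row_gamma /row_merge /= ?leqnn ?ltnn eqxx; case: asboolP => //= _.
  + by case=> /esym/n_Sn.
  + by case=> /n_Sn.
- move=> [i j] [/= Hi Hj] HN; rewrite /row_gamma /row_merge /in_grid /=.
  case: (ltngtP j r) => jr /=.
  + by rewrite jr; split=> //; split=> //; apply: ltn_trans jr Hr.
  (* Lowering and raising restores [j] unless [j = r.+1] in a column meeting [S], which is a
     forbidden cell. *)
  + have Ej := ltn_predK jr; rewrite Ej leqNgt jr /= -ltnS; split=> //.
    case: eqP => //= jr'.
    case: asboolP => // ci; case: HN; right; exists i => //.
    by rewrite -jr' Ej.
  + rewrite jr ltnn eqxx /=; case: asboolP => //= ci.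
    by case: HN; left; exists i => //; rewrite jr.
Qed.

Lemma num_Grid_col_separated (n : nat) : r < width T ->
  S `<=` col_cells T r -> col_sep_applies T r S ->
  num_Grid T n = num_Grid (col_separated T r S) n.
Proof.
move=> Hr HS sep.
apply: (@num_Grid_relabel _ _ _ _ _ _ (col_merge r)) => //.
- exact: col_gammaK.
- by move=> c d; apply: merge_homo.
- by move=> c [c1 c2]; rewrite /col_gamma; case: ifP; split=> //; apply: ltnW.
- by move=> g; apply: gridded_col_gamma.
- by move=> o; apply: col_critical_map_cells.
- move=> o [[i [_ ni] <-]|[i ci <-]];
    [exists (r, i) => //|exists (r.+1, i) => //];
    rewrite /col_gamma /col_merge /= ?leqnn ?ltnn eqxx; case: asboolP => //= _.
  + by case=> /esym/n_Sn.
  + by case=> /n_Sn.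
- move=> [i j] [/= Hi Hj] HN; rewrite /col_gamma /col_merge /in_grid /=.
  case: (ltngtP i r) => ir /=.
  + by rewrite ir; split=> //; split=> //; apply: ltn_trans ir Hr.
  (* The only exception is [i = r.+1] in a row meeting [S], again a forbidden cell. *)
  + have Ei := ltn_predK ir; rewrite Ei leqNgt ir /= -ltnS; split=> //.
    case: eqP => //= ir'.
    case: asboolP => // cj; case: HN; right; exists j => //.
    by rewrite -ir' Ei.
  + rewrite ir ltnn eqxx /=; case: asboolP => //= cj.
    by case: HN; left; exists j => //; rewrite ir.
Qed.

End Separation.

Theorem theorem6p14 (T : tiling) (Twf : tiling_wf T)
    (Tinc : incomparable (obs T)) :
  (forall (r : nat) (S : set cell),
      r < height T -> S !=set0 -> S `<=` row_cells T r ->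
      row_sep_applies T r S ->
      forall n : nat, num_Grid T n = num_Grid (row_separated T r S) n) /\
  (forall (r : nat) (S : set cell),
      r < width T -> S !=set0 -> S `<=` col_cells T r ->
      col_sep_applies T r S ->
      forall n : nat, num_Grid T n = num_Grid (col_separated T r S) n).
Proof.
split=> r S Hr _ HS sep n.
- exact: num_Grid_row_separated.
- exact: num_Grid_col_separated.
Qed.
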